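(* Consider a deterministic control problem with known initial state $x_S$, optimal control laws $u_k(\cdot)$, closed-loop maps $f_k^*(x)=f_k(x,u_k(x))$ and optimal trajectory $(x_{S+1}^*,\dots,x_T^* )$ (defined in the context). For functions $a=f_a$, $b=f_b$ on the state space let $a\otimes b=f_b\circ f_a$. If $a_S$ is initialised as the (constant) function $f_S^*$ evaluated at $x_S$, i.e. $a_S=f_S^*(x_S)$, and $a_k$ is initialised as the function $a_k=f_k^*(\cdot)$ for $k=S+1,\dots,T-1$, then for every $k=S+1,\dots,T$ $$a_S\otimes a_{S+1}\otimes\cdots\otimes a_{k-1}=x_k^*,$$ where $x_k^*$ is the state of the optimal trajectory at time step $k$ (the left-hand side being the constant function with that value).
   Context: Let $S<T$ be integers, $\mathcal X$ the state space and $\mathcal U$ the control space. For $n=S,\dots,T-1$ let $f_n:\mathcal X\times\mathcal U\to\mathcal X$ be the dynamics $x_{n+1}=f_n(x_n,u_n)$ and $\ell_n:\mathcal X\times\mathcal U\to\mathbb R$ the stage cost, and let $\ell_T:\mathcal X\to\mathbb R$ be the terminal cost, all costs bounded below. The value functions are $V_T=\ell_T$ and $V_k(x_k)=\min_{u_k}\{\ell_k(x_k,u_k)+V_{k+1}(f_k(x_k,u_k))\}$. The optimal control law is $u_k(x_k)=\arg\min_{u_k}\{\ell_k(x_k,u_k)+V_{k+1}(f_k(x_k,u_k))\}$ (a minimiser is assumed to exist and one is fixed). The optimal trajectory is defined by $x_S^*=x_S$ and $x_{k+1}^*=f_k(x_k^*,u_k(x_k^* ))=f_k^*(x_k^* )$.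 *)

(* Defs.v *)
From mathcomp Require Import all_boot all_order all_algebra.
From mathcomp Require Import all_classical all_reals.
Set Implicit Arguments.
Unset Strict Implicit.
Unset Printing Implicit Defensive.
Import Order.TTheory GRing.Theory Num.Theory.
Local Open Scope ring_scope.
Local Open Scope classical_set_scope.

(* Time steps are integers.  All time-indexed families are total functions of
   the time step; they are only constrained on the horizon [S, T] (dynamics,
   stage costs and control laws on [S, T - 1]), and their other values are
   irrelevant. *)

Definition costs_bounded_below (R : realType) (X U : Type) (S T : int)
    (ell : int -> X -> U -> R) (ellT : X -> R) : Prop :=
  (forall n, S <= n < T -> has_lbound (range (fun z : X * U => ell n z.1 z.2)))
  /\ has_lbound (range ellT).

Definition cost_to_go (R : realType) (X U : Type) (f : int -> X -> U -> X)
    (ell : int -> X -> U -> R) (V : int -> X -> R) (k : int) (x : X) (v : U)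
    : R :=
  ell k x v + V (k + 1) (f k x v).

Definition is_minimum (R : realType) (A : set R) (m : R) : Prop :=
  A m /\ lbound A m.

(* The minimum in the Bellman recursion is attained by definition of
   [is_minimum]; the recursion determines V on [S, T]. *)
Definition is_value_function (R : realType) (X U : Type) (S T : int)
    (f : int -> X -> U -> X) (ell : int -> X -> U -> R) (ellT : X -> R)
    (V : int -> X -> R) : Prop :=
  V T = ellT /\
  forall k : int, S <= k < T -> forall x,
    is_minimum (range (cost_to_go f ell V k x)) (V k x).

(* u is a fixed selection of minimisers, which need not be unique. *)
Definition is_optimal_control_law (R : realType) (X U : Type) (S T : int)
    (f : int -> X -> U -> X) (ell : int -> X -> U -> R)
    (V : int -> X -> R) (u : int -> X -> U) : Prop :=
  forall k : int, S <= k < T -> forall x v,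
    cost_to_go f ell V k x (u k x) <= cost_to_go f ell V k x v.

Definition closed_loop (X U : Type) (f : int -> X -> U -> X)
    (u : int -> X -> U) (k : int) (x : X) : X :=
  f k x (u k x).

Definition is_closed_loop_trajectory (X U : Type) (S T : int)
    (f : int -> X -> U -> X) (u : int -> X -> U) (xS : X)
    (xstar : int -> X) : Prop :=
  xstar S = xS /\
  forall k : int, S <= k < T -> xstar (k + 1) = closed_loop f u k (xstar k).

Definition otimes (X : Type) (a b : X -> X) : X -> X := b \o a.

(* a_m (x) a_(m+1) (x) ... (x) a_(k-1), for m <= k; otimes is associative with
   unit idfun, so the bracketing and the final unit do not matter. *)
Definition otimes_range (X : Type) (a : int -> X -> X) (m k : int) : X -> X :=
  \big[@otimes X/idfun]_(0 <= i < `|k - m|%N) a (m + i%:Z).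

(* Main.v *)
Require Import Defs.
From HB Require Import structures.
From mathcomp Require Import all_boot all_order all_algebra.
From mathcomp Require Import all_classical all_reals.
From mathcomp Require Import zify.
Set Implicit Arguments.
Unset Strict Implicit.
Unset Printing Implicit Defensive.
Import Order.TTheory GRing.Theory Num.Theory.
Local Open Scope ring_scope.
Local Open Scope classical_set_scope.

(** Since [otimes] applies its left factor first, a product of the [a k] runs the closed loop
    forward in time. Its first factor is the constant map with value $f_S^*(x_S) = x_{S+1}^*$, so
    every prefix product is constant, and appending one more $f_k^*$ moves its value one step along
    the trajectory. The proof is an induction on the number of factors, with [otimes_range_succ]
    splitting off the last one. *)

(** The monoid laws of composition hold by conversion; declaring them lets the generic big-operator
    lemmas isolate the last factor. *)
HB.instance Definition _ (X : Type) :=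
  Monoid.isLaw.Build (X -> X) idfun (@otimes X)
    (fun _ _ _ => erefl) (fun _ => erefl) (fun _ => erefl).

Lemma otimes_range_succ (X : Type) (a : int -> X -> X) (m : int) (n : nat) :
  otimes_range a m (m + n.+1%:Z) =
  otimes (otimes_range a m (m + n%:Z)) (a (m + n%:Z)).
Proof. by rewrite /otimes_range ![_ - m]addrC !addKr big_nat_recr. Qed.

Lemma otimes_range1 (X : Type) (a : int -> X -> X) (m : int) :
  otimes_range a m (m + 1) = a m.
Proof. by rewrite /otimes_range addrC addKr big_nat1 addr0. Qed.

Theorem lemma9 (R : realType) (X U : Type) (S T : int) (hST : S < T)
    (f : int -> X -> U -> X) (ell : int -> X -> U -> R) (ellT : X -> R)
    (hbnd : costs_bounded_below S T ell ellT)
    (V : int -> X -> R) (hV : is_value_function S T f ell ellT V)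
    (u : int -> X -> U) (hu : is_optimal_control_law S T f ell V u)
    (xS : X) (xstar : int -> X)
    (hxstar : is_closed_loop_trajectory S T f u xS xstar)
    (a : int -> X -> X)
    (haS : a S = cst (closed_loop f u S xS))
    (ha : forall k : int, S + 1 <= k <= T - 1 -> a k = closed_loop f u k) :
  forall k : int, S + 1 <= k <= T -> otimes_range a S k = cst (xstar k).
Proof.
move=> k /andP[Sk kT]; case: hxstar => xS0 xstep.
(* Here [n.+1] counts the factors. The induction starts at one factor because the empty product is
   [idfun], which is not constant in general. *)
have [n kE] : exists n : nat, k = S + n.+1%:Z by exists `|k - S|.-1%N; lia.
rewrite {}kE in kT *; clear Sk; elim: n kT => [|n IHn] nT.
  by rewrite otimes_range1 haS xstep ?xS0 // lexx.
rewrite otimes_range_succ IHn; last by lia.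
rewrite ha; last by lia.
have -> : S + n.+2%:Z = S + n.+1%:Z + 1 by lia.
(* Both sides are now convertible: a constant map followed by [g] is the constant map at the image
   under [g]. *)
by rewrite xstep //; lia.
Qed.
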